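(* Let $G$ be a (nonempty) groupoid and let $R$ be a nonzero $s$-unital ring. The following statements are equivalent: (i) the groupoid ring $R[G]$ is prime; (ii) $G$ is connected and there is some $e\in G_0$ such that the group ring $R[G_e^e]$ is prime; (iii) $G$ is connected and, for every $e\in G_0$, the group ring $R[G_e^e]$ is prime; (iv) there is some $e\in G_0$ such that $\mathcal{O}_e$ is $R$-dense and $R[G_e^e]$ is prime; (v) for every $e\in G_0$, $\mathcal{O}_e$ is $R$-dense and $R[G_e^e]$ is prime; (vi) $G$ is connected, $R$ is prime and there is some $e\in G_0$ such that $G_e^e$ has no non-trivial finite normal subgroup; (vii) $G$ is connected, $R$ is prime and, for every $e\in G_0$, $G_e^e$ has no non-trivial finite normal subgroup; (viii) $R$ is prime, and there is some $e\in G_0$ such that $\mathcal{O}_e$ is $R$-dense and $G_e^e$ has no non-trivial finite normal subgroup; (ix) $R$ is prime, and for every $e\in G_0$, $\mathcal{O}_e$ is $R$-dense and $G_e^e$ has no non-trivial finite normal subgroup.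
   Context: All rings are associative but not necessarily unital; ideals are two-sided. A ring is prime if it has no nonzero ideals $I,J$ with $IJ=\{0\}$. A ring $R$ is $s$-unital if for every $x\in R$ there are $a,b\in R$ with $ax=x=xb$. A groupoid $G$ is a small category in which every morphism is invertible; $G$ also denotes its set of morphisms. Objects are identified with identity morphisms, so the set of objects $G_0$ is a subset of $G$. The maps $s,r:G\to G_0$ are source and range; $gh$ is defined iff $s(g)=r(h)$. $G$ is connected if for all $e,f\in G_0$ there is $g\in G$ with $s(g)=e$ and $r(g)=f$. For $e\in G_0$, $G_e^e:=\{g\in G: s(g)=r(g)=e\}$ is the isotropy group, and $\mathcal{O}_e:=\{f\in G_0:\exists g\in G,\ s(g)=e,\ r(g)=f\}$. The groupoid ring $R[G]$ consists of the formal sums $\sum_{g\in G}a_g\delta_g$ with $a_g\in R$ zero for all but finitely many $g$, with pointwise addition and multiplication determined by $a\delta_g\cdot b\delta_h=ab\,\delta_{gh}$ if $s(g)=r(h)$, and $0$ otherwise. For $a=\sum a_g\delta_g$, $\mathrm{Supp}(a)=\{g\in G: a_g\neq0\}$. A subset $X\subseteq G_0$ is $R$-dense if for every nonzero $a\in R[G]$ there is some $g\in\mathrm{Supp}(a)$ with $s(g)\in X$. *)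

(* Defs.v *)
From HB Require Import structures.
From mathcomp Require Import all_boot all_algebra.
From mathcomp Require Import finmap monalg.
From mathcomp Require Import classical_sets.

Set Implicit Arguments.
Unset Strict Implicit.
Unset Printing Implicit Defensive.

Import GRing.Theory.

Local Open Scope classical_set_scope.
Local Open Scope ring_scope.

(* MathComp rings are unital, so a ring without unit is a Z-module together   *)
(* with a semigroup law, written (x * y)%g, that distributes over the sum.    *)
HB.mixin Record Zmodule_isRng R of GRing.Zmodule R & Semigroup R := {
  rmulDl : forall x y z : R, ((x + y)%R * z)%g = (x * z)%g + (y * z)%g;
  rmulDr : forall x y z : R, (x * (y + z)%R)%g = (x * y)%g + (x * z)%g
}.

#[short(type="rngType")]
HB.structure Definition Rng :=
  {R of Zmodule_isRng R & GRing.Zmodule R & Semigroup R}.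

Section RngTheory.
Context (R : rngType).
Implicit Types x y : R.

Lemma rmul0r x : (0%R * x)%g = 0.
Proof. by apply: (addrI (0%R * x)%g); rewrite -rmulDl !addr0. Qed.

Lemma rmulr0 x : (x * 0%R)%g = 0.
Proof. by apply: (addrI (x * 0%R)%g); rewrite -rmulDr !addr0. Qed.

Definition is_ideal (I : set R) : Prop :=
  [/\ I 0,
      forall x y, I x -> I y -> I (x - y) &
      forall a x, I x -> I (a * x)%g /\ I (x * a)%g].

Definition ideal_mul (I J : set R) : set R :=
  [set z | exists2 s : seq (R * R),
     forall p, p \in s -> I p.1 /\ J p.2 &
     z = \sum_(p <- s) (p.1 * p.2)%g].

Definition prime_ring : Prop :=
  ~ exists I J : set R,
      [/\ is_ideal I, is_ideal J, I <> [set 0], J <> [set 0] &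
          ideal_mul I J = [set 0]].

Definition s_unital : Prop :=
  forall x, exists a b : R, (a * x)%g = x /\ x = (x * b)%g.

End RngTheory.

Arguments prime_ring R : clear implicits.
Arguments s_unital R : clear implicits.

(* [gcomp g h] is the composite of h followed by g; its value is irrelevant   *)
(* unless [gsrc g = grng h].                                                   *)
Record groupoid := Groupoid {
  obj : choiceType;
  mor :> choiceType;
  gsrc : mor -> obj;
  grng : mor -> obj;
  gid : obj -> mor;
  gcomp : mor -> mor -> mor;
  ginv : mor -> mor;
  gsrc_id : forall e, gsrc (gid e) = e;
  grng_id : forall e, grng (gid e) = e;
  gsrc_comp : forall g h, gsrc g = grng h -> gsrc (gcomp g h) = gsrc h;
  grng_comp : forall g h, gsrc g = grng h -> grng (gcomp g h) = grng g;
  gcompA : forall g h k, gsrc g = grng h -> gsrc h = grng k ->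
    gcomp g (gcomp h k) = gcomp (gcomp g h) k;
  gcomp_idl : forall g, gcomp (gid (grng g)) g = g;
  gcomp_idr : forall g, gcomp g (gid (gsrc g)) = g;
  gsrc_inv : forall g, gsrc (ginv g) = grng g;
  grng_inv : forall g, grng (ginv g) = gsrc g;
  gcomp_invl : forall g, gcomp (ginv g) g = gid (gsrc g);
  gcomp_invr : forall g, gcomp g (ginv g) = gid (grng g)
}.

Definition groupoid_connected (G : groupoid) : Prop :=
  forall e f : obj G, exists2 g : G, gsrc g = e & grng g = f.

Definition groupoid_orbit (G : groupoid) (e : obj G) : set (obj G) :=
  [set f | exists2 g : G, gsrc g = e & grng g = f].

Section Isotropy.
Context (G : groupoid) (e : obj G).

Record isotropy := Isotropy {
  isotropy_mor :> G;
  isotropyP : (gsrc isotropy_mor == e) && (grng isotropy_mor == e)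
}.

HB.instance Definition _ := [isSub for isotropy_mor].
HB.instance Definition _ := [Choice of isotropy by <:].

Lemma isotropy_src (x : isotropy) : gsrc x = e.
Proof. by case/andP: (isotropyP x) => /eqP. Qed.

Lemma isotropy_rng (x : isotropy) : grng x = e.
Proof. by case/andP: (isotropyP x) => _ /eqP. Qed.

Fact isotropy_one_subproof : (gsrc (gid e) == e) && (grng (gid e) == e).
Proof. by rewrite gsrc_id grng_id eqxx. Qed.

Fact isotropy_inv_subproof (x : isotropy) :
  (gsrc (ginv x) == e) && (grng (ginv x) == e).
Proof. by rewrite gsrc_inv grng_inv isotropy_src isotropy_rng eqxx. Qed.

Fact isotropy_mul_subproof (x y : isotropy) :
  (gsrc (gcomp x y) == e) && (grng (gcomp x y) == e).
Proof.
by rewrite gsrc_comp ?grng_comp ?isotropy_src ?isotropy_rng ?eqxx.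
Qed.

Definition isotropy_one := Isotropy isotropy_one_subproof.
Definition isotropy_inv x := Isotropy (isotropy_inv_subproof x).
Definition isotropy_mul x y := Isotropy (isotropy_mul_subproof x y).

Fact isotropy_mulA : associative isotropy_mul.
Proof.
by move=> x y z; apply/val_inj/gcompA; rewrite isotropy_src isotropy_rng.
Qed.

Fact isotropy_mul1x : left_id isotropy_one isotropy_mul.
Proof.
by move=> x; apply/val_inj; rewrite /= -(isotropy_rng x) gcomp_idl.
Qed.

Fact isotropy_mulx1 : right_id isotropy_one isotropy_mul.
Proof.
by move=> x; apply/val_inj; rewrite /= -(isotropy_src x) gcomp_idr.
Qed.

Fact isotropy_mulVx : left_inverse isotropy_one isotropy_inv isotropy_mul.
Proof. by move=> x; apply/val_inj; rewrite /= gcomp_invl isotropy_src. Qed.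

Fact isotropy_mulxV : right_inverse isotropy_one isotropy_inv isotropy_mul.
Proof. by move=> x; apply/val_inj; rewrite /= gcomp_invr isotropy_rng. Qed.

HB.instance Definition _ := isGroup.Build isotropy
  isotropy_mulA isotropy_mul1x isotropy_mulx1 isotropy_mulVx isotropy_mulxV.

End Isotropy.

Section GroupoidRing.
Context (R : rngType) (G : groupoid).

Definition groupoid_ring := {malg R[mor G]}.

HB.instance Definition _ := GRing.Zmodule.on groupoid_ring.

Implicit Types (a b c : groupoid_ring) (g h k : G) (x y z : R).

Definition delta x g : groupoid_ring := << x *g g >>.

Definition delta_mul x g y h : groupoid_ring :=
  if gsrc g == grng h then delta (x * y)%g (gcomp g h) else 0.

Definition groupoid_ring_mul a b : groupoid_ring :=
  \sum_(g <- msupp a) \sum_(h <- msupp b) delta_mul a@_g g b@_h h.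

Fact delta_mul0l g y h : delta_mul 0 g y h = 0.
Proof. by rewrite /delta_mul rmul0r /delta monalgU0 if_same. Qed.

Fact delta_mul0r x g h : delta_mul x g 0 h = 0.
Proof. by rewrite /delta_mul rmulr0 /delta monalgU0 if_same. Qed.

Fact delta_mulDl x x' g y h :
  delta_mul (x + x') g y h = delta_mul x g y h + delta_mul x' g y h.
Proof.
by rewrite /delta_mul; case: ifP; rewrite ?addr0 // rmulDl /delta monalgUD.
Qed.

Fact delta_mulDr x g y y' h :
  delta_mul x g (y + y') h = delta_mul x g y h + delta_mul x g y' h.
Proof.
by rewrite /delta_mul; case: ifP; rewrite ?addr0 // rmulDr /delta monalgUD.
Qed.

Fact groupoid_ring_mulw (d1 d2 : {fset G}) a b :
  (msupp a `<=` d1)%fset -> (msupp b `<=` d2)%fset ->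
  groupoid_ring_mul a b =
  \sum_(g <- d1) \sum_(h <- d2) delta_mul a@_g g b@_h h.
Proof.
move=> le_d1 le_d2; rewrite /groupoid_ring_mul (big_fset_incl _ le_d1) /=.
  apply/eq_bigr=> g _; apply/big_fset_incl => // h _ /mcoeff_outdom ->.
  exact: delta_mul0r.
move=> g _ /mcoeff_outdom ag.
by rewrite big1 // => h _; rewrite ag delta_mul0l.
Qed.

Lemma groupoid_ring_mulUU x g y h :
  groupoid_ring_mul (delta x g) (delta y h) = delta_mul x g y h.
Proof.
by rewrite (groupoid_ring_mulw msuppU_le msuppU_le) !big_seq_fset1 !mcoeffUU.
Qed.

Fact groupoid_ring_mulDl a b c :
  groupoid_ring_mul (a + b) c = groupoid_ring_mul a c + groupoid_ring_mul b c.
Proof.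
pose d := (msupp a `|` msupp b)%fset.
rewrite (@groupoid_ring_mulw d (msupp c)) ?msuppD_le ?fsubset_refl //.
rewrite (@groupoid_ring_mulw d (msupp c) a) ?fsubsetUl ?fsubset_refl //.
rewrite (@groupoid_ring_mulw d (msupp c) b) ?fsubsetUr ?fsubset_refl //.
rewrite -big_split; apply: eq_bigr => g _ /=.
by rewrite -big_split; apply: eq_bigr => h _; rewrite mcoeffD delta_mulDl.
Qed.

Fact groupoid_ring_mulDr a b c :
  groupoid_ring_mul a (b + c) = groupoid_ring_mul a b + groupoid_ring_mul a c.
Proof.
pose d := (msupp b `|` msupp c)%fset.
rewrite (@groupoid_ring_mulw (msupp a) d) ?msuppD_le ?fsubset_refl //.
rewrite (@groupoid_ring_mulw (msupp a) d a b) ?fsubsetUl ?fsubset_refl //.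
rewrite (@groupoid_ring_mulw (msupp a) d a c) ?fsubsetUr ?fsubset_refl //.
rewrite -big_split; apply: eq_bigr => g _ /=.
by rewrite -big_split; apply: eq_bigr => h _; rewrite mcoeffD delta_mulDr.
Qed.

Fact groupoid_ring_mul0l a : groupoid_ring_mul 0 a = 0.
Proof. by rewrite /groupoid_ring_mul msupp0 big_seq_fset0. Qed.

Fact groupoid_ring_mul0r a : groupoid_ring_mul a 0 = 0.
Proof.
by rewrite /groupoid_ring_mul big1 // => g _; rewrite msupp0 big_seq_fset0.
Qed.

Fact groupoid_ring_mul_suml (I : Type) (s : seq I) (F : I -> groupoid_ring) a :
  groupoid_ring_mul (\sum_(i <- s) F i) a =
  \sum_(i <- s) groupoid_ring_mul (F i) a.
Proof.
apply: (big_morph (fun b => groupoid_ring_mul b a)) => [b c|].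
  exact: groupoid_ring_mulDl.
exact: groupoid_ring_mul0l.
Qed.

Fact groupoid_ring_mul_sumr (I : Type) (s : seq I) (F : I -> groupoid_ring) a :
  groupoid_ring_mul a (\sum_(i <- s) F i) =
  \sum_(i <- s) groupoid_ring_mul a (F i).
Proof.
apply: (big_morph (groupoid_ring_mul a)) => [b c|].
  exact: groupoid_ring_mulDr.
exact: groupoid_ring_mul0r.
Qed.

Fact groupoid_ring_mulUA x g y h z k :
  groupoid_ring_mul (delta x g) (groupoid_ring_mul (delta y h) (delta z k)) =
  groupoid_ring_mul (groupoid_ring_mul (delta x g) (delta y h)) (delta z k).
Proof.
rewrite !groupoid_ring_mulUU /delta_mul.
case: eqP => [hk|nhk]; case: eqP => [gh|ngh].
- rewrite !groupoid_ring_mulUU /delta_mul grng_comp // gh eqxx.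
  by rewrite gsrc_comp // hk eqxx mulgA gcompA.
- rewrite groupoid_ring_mul0l groupoid_ring_mulUU /delta_mul grng_comp //.
  by case: eqP.
- rewrite groupoid_ring_mul0r groupoid_ring_mulUU /delta_mul gsrc_comp //.
  by case: eqP.
- by rewrite groupoid_ring_mul0r groupoid_ring_mul0l.
Qed.

Fact groupoid_ring_mulA : associative groupoid_ring_mul.
Proof.
move=> a b c.
have E d : d = \sum_(g <- msupp d) delta d@_g g by exact: monalgE.
rewrite [a]E !groupoid_ring_mul_suml; apply: eq_bigr => g _.
rewrite [b]E !(groupoid_ring_mul_suml, groupoid_ring_mul_sumr).
apply: eq_bigr => h _.
rewrite [c]E !groupoid_ring_mul_sumr; apply: eq_bigr => k _.
exact: groupoid_ring_mulUA.
Qed.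

HB.instance Definition _ :=
  isSemigroup.Build groupoid_ring groupoid_ring_mulA.
HB.instance Definition _ :=
  Zmodule_isRng.Build groupoid_ring groupoid_ring_mulDl groupoid_ring_mulDr.

Definition ring_dense (X : set (obj G)) : Prop :=
  forall a, a != 0 -> exists2 g, g \in msupp a & X (gsrc g).

End GroupoidRing.

Arguments delta {R G} x g.
Arguments groupoid_ring_mul {R G} a b.
Arguments ring_dense R {G} X.

(* A group is a groupoid with one object, and its group ring is the           *)
(* corresponding groupoid ring.                                               *)
Definition group_groupoid (H : groupType) : groupoid :=
  {| obj := unit; mor := H;
     gsrc := fun=> tt; grng := fun=> tt; gid := fun=> 1%g;
     gcomp := fun g h => (g * h)%g; ginv := fun g => (g^-1)%g;
     gsrc_id := fun 'tt => erefl; grng_id := fun 'tt => erefl;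
     gsrc_comp := fun _ _ _ => erefl; grng_comp := fun _ _ _ => erefl;
     gcompA := fun g h k _ _ => mulgA g h k;
     gcomp_idl := mul1g; gcomp_idr := mulg1;
     gsrc_inv := fun=> erefl; grng_inv := fun=> erefl;
     gcomp_invl := mulVg; gcomp_invr := @mulgV H |}.

Notation group_ring R H := (groupoid_ring R (group_groupoid H)).

Definition no_nontrivial_finite_normal_subgroup (H : groupType) : Prop :=
  forall N : {fset H},
    group_closed [in N] -> (forall x y : H, x \in N -> (x ^ y)%g \in N) ->
    N = [fset 1%g]%fset.

(* Main.v *)
Require Import Defs.
From mathcomp Require Import all_boot all_algebra.
From mathcomp Require Import finmap monalg.
From mathcomp Require Import boolp classical_sets.

(** The theorem combines a reduction to one isotropy group with a
    characterisation of the prime group rings.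

    Reduction. As [R] has a nonzero element, [ring_dense] says that a set of
    objects contains every object, so density of an orbit is connectedness.
    A prime groupoid ring forces connectedness ([prime_connected]). When the
    groupoid is connected, the group ring of the isotropy group at any object
    [e] plays the role of a corner [1_e R[G] 1_e] of the groupoid ring: it
    embeds through [isotropy_extend], and local units of [R] carry any nonzero
    element into it ([isotropy_corner_neq0]). Primeness passes in both
    directions, for every [e] ([prime_isotropy], [connected_prime]).

    Group rings (a form of Connell's theorem). If [R[H]] is prime, then so is
    [R], and the sum over a finite normal subgroup [N] kills [1 - n] for [n] in
    [N], so that [N] is trivial. For the converse, let [a] and [b] be nonzero.
    The elements of [H] with finitely many conjugates form a subgroup, which is
    torsion free and abelian when [H] has no nontrivial finite normal subgroup
    ([fin_conj_torsion_free], [fin_conj_commute]). Such a group is orderable on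
    finite sets, so finite sets have unique products ([unique_product]). The
    remaining elements of the support of [a] have infinite classes, and a
    single conjugation moves them out of any prescribed finite set while it
    fixes the others ([separation]). These two facts isolate one coefficient of
    some [a * delta r k * b] as a product [x * r * y] with [x] and [y] nonzero
    in [R], and primeness of [R] provides [r] making it nonzero
    ([no_finite_normal_prime]). *)

Set Implicit Arguments.
Unset Strict Implicit.
Unset Printing Implicit Defensive.

Import GRing.Theory.

(** * Powers of a finite set closed under conjugation *)

Section FiniteConjugacy.
Local Open Scope fset_scope.
Local Open Scope group_scope.
Context {H : groupType}.
Implicit Types (a b x y z g h s t u : H) (S E : {fset H}).
Implicit Types (l F Y : seq H) (m n : nat).

Definition conj_closed S := forall s t, s \in S -> t \in S -> s ^ t \in S.

Fixpoint set_power S m : {fset H} :=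
  if m is m'.+1 then [fset s * x | s in S, x in set_power S m'] else [fset 1].

Lemma set_powerP S m x :
  reflect (exists l, [/\ size l = m, {subset l <= S} & x = \prod_(s <- l) s])
          (x \in set_power S m).
Proof.
elim: m x => [|m IHm] x /=.
  rewrite inE; apply: (iffP eqP) => [->|[l [/size0nil -> _ ->]]].
    by exists [::]; split=> //; rewrite big_nil.
  by rewrite big_nil.
apply: (iffP idP) => /=.
  case/imfset2P=> s /= sS [y /= /IHm[l [<- lS ->]] ->]; exists (s :: l).
  by rewrite big_cons; split=> // t /predU1P[->|/lS].
case=> -[|s l] [] // [sl] lS ->; rewrite big_cons.
apply: in_imfset2 => /=; first by rewrite lS ?mem_head.
by apply/IHm; exists l; split=> // t tl; rewrite lS // inE tl orbT.
Qed.

Lemma set_power_conj S m g x : (forall s, s \in S -> s ^ g \in S) ->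
  x \in set_power S m -> x ^ g \in set_power S m.
Proof.
move=> Sg /set_powerP[l [<- lS ->]].
apply/set_powerP; exists [seq s ^ g | s <- l].
by rewrite size_map conjg_prod big_map; split=> // _ /mapP[s /lS/Sg ? ->].
Qed.

Lemma card_mull s E : #|` [fset s * x | x in E]| = #|` E|.
Proof. by rewrite card_imfset //; apply: mulgI. Qed.

Lemma card_set_power_homo S s : s \in S ->
  {homo (fun m => #|` set_power S m|) : m n / (m <= n)%N}.
Proof.
move=> sS; apply: homo_leq => [//|m n p|m]; first exact: leq_trans.
rewrite -(card_mull s) fsubset_leq_card //.
by apply/fsubsetP => _ /imfsetP[x /= xm ->]; apply: in_imfset2.
Qed.

(** Since [x * y = y * x ^ y], all occurrences of [s] in a product can be moved
    to the front, at the cost of conjugating the other factors inside [S]. *)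
Lemma prod_extract S s l : conj_closed S -> s \in S -> {subset l <= S} ->
  exists l', [/\ {subset l' <= S}, (size l' + count_mem s l = size l)%N &
    \prod_(t <- l) t = s ^+ count_mem s l * \prod_(t <- l') t].
Proof.
move=> cS sS; elim: l => [|t l IHl] lS.
  by exists [::]; rewrite expg0 mul1g.
have [|l' [l'S l'sz l'E]] := IHl.
  by move=> u ul; rewrite lS // inE ul orbT.
have tS : t \in S by rewrite lS ?mem_head.
rewrite big_cons l'E /=; have [->|_] := eqVneq.
  by exists l'; rewrite add1n addnS l'sz expgS mulgA.
exists (t ^ (s ^+ count_mem s l) :: l'); split=> [u /predU1P[->|/l'S//]||].
- elim: (count_mem s l) => [|c IHc]; first by rewrite expg0 conjg1.
  by rewrite expgSr conjgM cS.
- by rewrite add0n /= addSn l'sz.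
- by rewrite add0n big_cons [RHS]mulgA -conjgC mulgA.
Qed.

(** Pigeonhole: it forces some letter to repeat often in a long word. *)
Lemma size_count_bound (T : eqType) (r l : seq T) n :
  {subset l <= r} -> (forall t : T, count_mem t l <= n)%N ->
  (size l <= size r * n)%N.
Proof.
elim: r l => [|t r IHr] l lr cl.
  by case: l lr {cl} => // a l /(_ a (mem_head _ _)).
rewrite -(count_predC (pred1 t)) mulSn leq_add ?cl // -size_filter.
apply: IHr => u.
  rewrite mem_filter /= => /andP[ut /lr].
  by rewrite inE (negPf ut).
by apply: leq_trans (cl u); apply/leq_count_subseq/filter_subseq.
Qed.

(** In a word of length [L = #|S| * n + n + 1], some letter occurs at least
    [n + 1] times; extracting these occurrences gives a factor [z], so that
    [S^L] is contained in [z S^(L - n - 1)]. As left multiplication by an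
    element of [S] makes cardinals of powers nondecreasing, [S^(L - 1)] and
    [S^L] have the same cardinal. With [E = S^(L - 1)] this gives
    [s E = S^L = t E] for all [s] and [t] in [S]. The lemma serves twice: with
    [z = 1] for the absence of torsion, and with a common power [z] of two
    conjugates for commutativity. *)
Lemma set_power_stabilizer S n z :
    conj_closed S -> (forall s, s \in S -> s ^+ n.+1 = z) ->
  exists m, forall s t, s \in S -> t \in S ->
    forall x, x \in set_power S m -> s^-1 * t * x \in set_power S m.
Proof.
move=> cS Sz; exists (#|` S| * n + n)%N => s t sS tS x xE.
set E := set_power S _ in xE *.
have leE : (#|` set_power S (#|` S| * n + n).+1| <= #|` E|)%N.
  apply: leq_trans (card_set_power_homo sS (leq_addr n (#|` S| * n)%N)).
  rewrite -[leqRHS](card_mull z) fsubset_leq_card //.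
  apply/fsubsetP => w /set_powerP[l [lsz lS ->]] {w}.
  have /existsNP[u /negP] : ~ forall u, (count_mem u l <= n)%N.
    move=> /(size_count_bound lS); rewrite lsz => /leq_trans.
    by move=> /(_ _ (leq_addr n _)); rewrite ltnn.
  rewrite -ltnNge => ltnu.
  have uS : u \in S.
    by apply/lS; rewrite -has_pred1 has_count (leq_trans _ ltnu).
  have [l' [l'S l'sz ->]] := prod_extract cS uS lS.
  apply/imfsetP; exists (u ^+ (count_mem u l - n.+1) * \prod_(v <- l') v) => /=.
    apply/set_powerP; exists (nseq (count_mem u l - n.+1) u ++ l'); split.
    - rewrite size_cat size_nseq; apply/eqP.
      rewrite -(eqn_add2r n.+1) -addnA [(size l' + _)%N]addnC addnA subnK //.
      by rewrite addnC l'sz lsz addnS.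
    - by move=> v; rewrite mem_cat mem_nseq => /orP[/andP[_ /eqP->//]|/l'S].
    - by rewrite big_cat /= big_nseq iter_mulg_1.
  by rewrite mulgA -(Sz _ uS) -expgnDr subnKC.
have sE : [fset s * y | y in E] = set_power S (#|` S| * n + n).+1.
  apply/eqP; rewrite eqEfcard card_mull leE andbT.
  by apply/fsubsetP => _ /imfsetP[y /= yE ->]; apply: in_imfset2.
have : t * x \in [fset s * y | y in E] by rewrite sE; apply: in_imfset2.
by case/imfsetP => y /= yE txE; rewrite -mulgA txE mulKg.
Qed.

Lemma expg_set_power S m s : s \in S -> s ^+ m \in set_power S m.
Proof.
move=> sS; apply/set_powerP; exists (nseq m s).
rewrite size_nseq big_nseq iter_mulg_1; split=> // t.
by rewrite mem_nseq => /andP[_ /eqP->].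
Qed.

Lemma stabilizer_torsion E e u : e \in E ->
  (forall x, x \in E -> u * x \in E) -> exists n, u ^+ n.+1 = 1.
Proof.
move=> eE uE.
have uiE i : u ^+ i * e \in E.
  by elim: i => [|i IHi]; rewrite ?expg0 ?mul1g // expgS -mulgA uE.
pose r := [seq u ^+ i * e | i <- iota 0 #|` E|.+1].
have /(uniqPn 1)[i [j [lt_ij]]] : ~~ uniq r.
  apply/negP => /uniq_leq_size/(_ (_ : {subset r <= E})) leE.
  have: (size r <= #|` E|)%N by apply: leE => _ /mapP[i _ ->].
  by rewrite size_map size_iota ltnn.
rewrite size_map size_iota => ltjE.
rewrite !(nth_map 0%N) ?size_iota ?(ltn_trans lt_ij) //.
rewrite !nth_iota ?(ltn_trans lt_ij) // !add0n => /mulIg uij.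
exists (j - i).-1; rewrite prednK ?subn_gt0 //.
by rewrite expgnFr 1?ltnW // uij mulgV.
Qed.

(** * Elements with finitely many conjugates *)

(** Membership in the FC-centre. A list that contains the conjugacy class,
    rather than the class itself, makes the closure properties immediate. *)
Definition fin_conj x := exists r : seq H, forall g, x ^ g \in r.

Lemma fin_conjM x y : fin_conj x -> fin_conj y -> fin_conj (x * y).
Proof.
move=> [r xr] [q yq]; exists [seq a * b | a <- r, b <- q] => g.
rewrite conjMg; apply/allpairsP.
by exists (x ^ g, y ^ g); split; rewrite ?xr ?yq.
Qed.

Lemma fin_conjV x : fin_conj x -> fin_conj x^-1.
Proof.
move=> [r xr]; exists [seq a^-1 | a <- r] => g.
by rewrite conjVg; apply/mapP; exists (x ^ g).
Qed.

Lemma fin_conjF x y : fin_conj x -> fin_conj y -> fin_conj (x / y).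
Proof. by move=> fx fy; apply: fin_conjM (fin_conjV fy). Qed.

Lemma fin_conj1 : fin_conj 1.
Proof. by exists [:: 1] => g; rewrite conj1g inE. Qed.

Lemma fin_conj_class x : fin_conj x ->
  exists S, forall y, (y \in S) <-> exists g, y = x ^ g.
Proof.
move=> [r xr]; exists [fset y in r | `[<exists g, y = x ^ g>]] => y.
rewrite !inE /=; split=> [/andP[_ /asboolP//]|[g ->]].
by rewrite xr; apply/asboolP; exists g.
Qed.

(** * Torsion and commutation when there is no finite normal subgroup *)

Context (Hnofin : no_nontrivial_finite_normal_subgroup H).

(** If [x] has order dividing [n + 1], so do all elements of
    [S = {1} U x^H], and [set_power_stabilizer] gives a finite power [E] of
    [S] with [x E = E]. The set [N] of all [h] with [h E = E] is a subgroup;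
    it lies in [E] because [1] is in [E], and it is normal because [E] is
    invariant under conjugation. Hence [N] is trivial, although it contains
    [x]. *)
Lemma fin_conj_torsion_free x n : fin_conj x -> x ^+ n.+1 = 1 -> x = 1.
Proof.
move=> /fin_conj_class[X XE] xn1; pose S := 1 |` X.
have Sg g s : s \in S -> s ^ g \in S.
  rewrite !inE => /orP[/eqP->|/XE[h ->]]; first by rewrite conj1g eqxx.
  by apply/orP; right; apply/XE; exists (h * g); rewrite conjgM.
have Sn s : s \in S -> s ^+ n.+1 = 1.
  rewrite !inE => /orP[/eqP->|/XE[h ->]]; first by rewrite expg1n.
  by rewrite -conjXg xn1 conj1g.
have [m mE] := @set_power_stabilizer S n 1 (fun s t sS _ => Sg t s sS) Sn.
set E := set_power S m in mE.
have S1 : 1 \in S by rewrite !inE eqxx.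
have xS : x \in S.
  by rewrite !inE; apply/orP; right; apply/XE; exists 1; rewrite conjg1.
have E1 : 1 \in E by rewrite -(expg1n H m) expg_set_power.
pose N := [fset h in E | all (fun y => h * y \in E) E].
have NP h : reflect (forall y, y \in E -> h * y \in E) (h \in N).
  rewrite !inE /=; apply: (iffP andP) => [[_ /allP//]|hE].
  by split; [rewrite -[h]mulg1 hE | apply/allP].
have NV h : h \in N -> h^-1 \in N.
  move=> /NP hE; apply/NP => y yE.
  have hEE : [fset h * y | y in E] = E.
    apply/eqP; rewrite eqEfcard card_mull leqnn andbT.
    by apply/fsubsetP => _ /imfsetP[z /= zE ->]; apply: hE.
  by move: yE; rewrite -{1}hEE => /imfsetP[z /= zE ->]; rewrite mulKg.
have Ntriv : N = [fset 1].
  apply: Hnofin => [|a g aN].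
    split=> [|a b aN /NV bN]; first by apply/NP => y; rewrite mul1g.
    by apply/NP => y yE; rewrite -mulgA (NP _ aN) // (NP _ bN).
  apply/NP => y yE; rewrite -[y](conjgKV g) -conjMg.
  by rewrite set_power_conj ?(NP _ aN) ?set_power_conj //; apply: Sg.
have : x \in N.
  by apply/NP => y /(mE _ _ S1 xS); rewrite invg1 mul1g.
by rewrite Ntriv inE => /eqP.
Qed.

(** Conjugation by [y] permutes the finite class of [x], so some power of it
    fixes [x]. *)
Lemma fin_conj_commute_power x y :
  fin_conj x -> exists n, commute x (y ^+ n.+1).
Proof.
move=> /fin_conj_class[X XE].
pose r := [seq x ^ (y ^+ i) | i <- iota 0 #|` X|.+1].
have /(uniqPn 1)[i [j [lt_ij]]] : ~~ uniq r.
  apply/negP => /uniq_leq_size/(_ (_ : {subset r <= X})) leX.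
  have: (size r <= #|` X|)%N.
    by apply: leX => _ /mapP[i _ ->]; apply/XE; exists (y ^+ i).
  by rewrite size_map size_iota ltnn.
rewrite size_map size_iota => ltjE.
rewrite !(nth_map 0%N) ?size_iota ?(ltn_trans lt_ij) //.
rewrite !nth_iota ?(ltn_trans lt_ij) // !add0n => xij.
exists (j - i).-1; rewrite prednK ?subn_gt0 //.
apply/commgP; rewrite -conjg_fix; apply/eqP.
by rewrite expgnFr 1?ltnW // conjgM -xij conjgK.
Qed.

(** A torsion-free group in which all classes are finite is abelian. If [x]
    commutes with [y ^+ n.+1], then [y] and [y ^ x] are conjugates of [y] with
    the same power [n + 1]. The conjugates with that property form a set
    closed under conjugation by its own elements, so [set_power_stabilizer]
    makes [y^-1 * y ^ x] stabilise a finite set; it is therefore a torsion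
    element, that is, [1]. *)
Lemma fin_conj_commute x y : fin_conj x -> fin_conj y -> commute x y.
Proof.
move=> fx fy; have [n xyn] := fin_conj_commute_power y fx.
have [Y YE] := fin_conj_class fy.
pose S := [fset s in Y | s ^+ n.+1 == y ^+ n.+1].
have Sn s : s \in S -> s ^+ n.+1 = y ^+ n.+1.
  by rewrite !inE => /andP[_ /eqP].
have cS : conj_closed S.
  move=> s t sS tS; rewrite !inE; apply/andP; split; last first.
    by rewrite -conjXg (Sn _ sS) -(Sn _ tS) conjXg [t ^ t]conjgE mulKg.
  move: sS; rewrite !inE => /andP[/YE[g ->] _].
  by apply/YE; exists (g * t); rewrite conjgM.
have [m mE] := set_power_stabilizer cS Sn.
have yS : y \in S.
  by rewrite !inE eqxx andbT; apply/YE; exists 1; rewrite conjg1.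
have yxS : y ^ x \in S.
  rewrite !inE -conjXg; apply/andP; split; first by apply/YE; exists x.
  by apply/eqP/conjg_fixP/commgP/commute_sym.
have [k] := stabilizer_torsion (expg_set_power m yS) (mE _ _ yS yxS).
rewrite -commgEl => /fin_conj_torsion_free yx1.
apply/commute_sym/commgP/eqP/yx1/fin_conjM; first exact: fin_conjV.
by case: fy => r yr; exists r => g; rewrite -conjgM.
Qed.

(** * Unique products *)

(** The strict positive cone of a partial order on the FC-centre that is
    compatible with multiplication. *)
Definition cone (P : H -> Prop) :=
  [/\ forall x y, P x -> P y -> P (x * y), ~ P 1 & forall x, P x -> fin_conj x].

Lemma coneX P x n : cone P -> P x -> P (x ^+ n.+1).
Proof.
by move=> [PM _ _] Px; elim: n => // n IHn; rewrite expgS; apply: PM.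
Qed.

(** The semigroup generated by [e] and [P]. The last clause of the definition
    excludes the empty product [e ^+ 0 * 1]. *)
Definition extended_cone (P : H -> Prop) e x :=
  exists n p, [/\ x = e ^+ n * p, P p \/ p = 1 & (0 < n)%N \/ P p].

Lemma extended_coneP P e : cone P -> fin_conj e -> ~ extended_cone P e 1 ->
  [/\ cone (extended_cone P e), forall x, P x -> extended_cone P e x &
      extended_cone P e e].
Proof.
move=> [PM P1 Pf] fe e1.
have fp p : P p \/ p = 1 -> fin_conj p by case=> [/Pf//|->]; apply: fin_conj1.
have feX n : fin_conj (e ^+ n).
  elim: n => [|n IHn]; [exact: fin_conj1 | rewrite expgS; exact: fin_conjM].
split.
- split=> // [x y|x [n [p [-> /fp pP _]]]]; last exact: fin_conjM.
  move=> [n [p [-> pP np]]] [m [q [-> qP mq]]].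
  exists (n + m)%N, (p * q); split.
  + rewrite expgnDr !mulgA; congr (_ * _); rewrite -!mulgA; congr (_ * _).
    by apply: fin_conj_commute => //; apply: fp.
  + case: pP qP => [pP|->] [qP|->]; rewrite ?mulg1 ?mul1g.
    * by left; apply: PM.
    * by left.
    * by left.
    * by right.
  + case: np => [n0|Pp]; first by left; rewrite addn_gt0 n0.
    by case: qP => [qP|->]; right; rewrite ?mulg1 //; apply: PM.
- move=> x Px; exists 0%N, x.
  by rewrite expg0 mul1g; split=> //; [left|right].
- by exists 1%N, 1; rewrite expg1 mulg1; split; [|right|left].
Qed.

(** If both extensions contain [1], then [e ^- n] and [e ^+ m] lie in [P] or
    are equal to [1], for positive [n] and [m]. They are not [1], by absence of
    torsion, and then [P] contains [(e ^- n) ^+ m * (e ^+ m) ^+ n = 1]. *)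
Lemma cone_choice P e : cone P -> fin_conj e -> e <> 1 ->
  ~ extended_cone P e 1 \/ ~ extended_cone P e^-1 1.
Proof.
move=> cP fe e1; apply/not_andP => -[[n [p [npE pP np]]] [m [q [mqE qP mq]]]].
have [PM P1 Pf] := cP.
have torsion k : (0 < k)%N -> e ^+ k <> 1.
  by case: k => // k _ ek; apply/e1/(fin_conj_torsion_free fe ek).
have n0 : (0 < n)%N.
  case: n np npE => // -[//|Pp]; rewrite expg0 mul1g => p1.
  by case: P1; rewrite p1.
have m0 : (0 < m)%N.
  case: m mq mqE => // -[//|Pq]; rewrite expg0 mul1g => q1.
  by case: P1; rewrite q1.
have pE : p = e ^- n by apply: (mulgI (e ^+ n)); rewrite -npE mulgV.
have qE : q = e ^+ m by apply: (mulgI (e^-1 ^+ m)); rewrite -mqE expVgn mulVg.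
case: qP => [qP|q1]; last by apply: (torsion m m0); rewrite -qE.
case: pP => [pP|p1]; last first.
  by apply: (torsion n n0); apply: invg_inj; rewrite -pE invg1.
apply: P1; have -> : 1 = p ^+ m.-1.+1 * q ^+ n.-1.+1.
  by rewrite !prednK // pE qE expVgn -!expgnA mulnC mulVg.
by apply: PM; apply: coneX.
Qed.

(** Signs are chosen for the elements of [l] one after the other. *)
Lemma exists_cone l : (forall a, a \in l -> fin_conj a) ->
  exists2 P, cone P & forall a, a \in l -> a <> 1 -> P a \/ P a^-1.
Proof.
elim: l => [|e l IHl] fl; first by exists (fun=> False); first split.
have [a al|P cP lP] := IHl; first by apply: fl; rewrite inE al orbT.
have fe : fin_conj e by apply: fl; rewrite mem_head.
have [->|/eqP e1] := eqVneq e 1.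
  by exists P => // a /predU1P[->|/lP].
have [/extended_coneP|/extended_coneP] := cone_choice cP fe e1.
  move=> /(_ cP fe)[cQ PQ Qe]; exists (extended_cone P e) => // a.
  by move=> /predU1P[->|/lP aP]; [left|move=> /aP[/PQ|/PQ]; [left|right]].
move=> /(_ cP (fin_conjV fe))[cQ PQ Qe]; exists (extended_cone P e^-1) => // a.
by move=> /predU1P[->|/lP aP]; [right|move=> /aP[/PQ|/PQ]; [left|right]].
Qed.

Lemma cone_max P c l : cone P -> c \in l ->
  (forall x y, x \in l -> y \in l -> x <> y -> P (x / y) \/ P (y / x)) ->
  exists2 m, m \in l & forall x, x \in l -> x = m \/ P (m / x).
Proof.
move=> [PM P1 _]; elim: l c => // d l IHl c _ totl.
case: l => [|c' l] in IHl totl *.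
  by exists d; rewrite ?mem_head // => x; rewrite inE => /eqP->; left.
have [||m ml mP] := IHl c'; first exact: mem_head.
  by move=> x y xl yl; apply: totl; rewrite inE ?xl ?yl orbT.
have ml' : m \in [:: d, c' & l] by rewrite in_cons ml orbT.
have [dm|/eqP dm] := eqVneq d m.
  by exists m => // x /predU1P[->|/mP//]; left.
have [//||Pdm|Pmd] := totl d m _ _ dm; rewrite ?mem_head //.
  exists d => [|x /predU1P[->|/mP[->|Pmx]]]; rewrite ?mem_head //.
  - by left.
  - by right.
  - by right; rewrite -(divgKA m); apply: PM.
by exists m => // x /predU1P[->|/mP//]; right.
Qed.

(** The FC-centre is abelian and a cone compares any finite set of its elements,
    so the product of the largest elements of two finite subsets is attained
    only once. As [B] may leave the FC-centre, the maximum is taken over the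
    part [B'] of [B] in the coset of [b]: products of [A] with the other
    cosets lie elsewhere. *)
Lemma unique_product (A B : seq H) a b : a \in A -> b \in B ->
    (forall x, x \in A -> fin_conj x) ->
  exists x0 y0, [/\ x0 \in A, y0 \in B &
    forall x y, x \in A -> y \in B -> x * y = x0 * y0 -> x = x0 /\ y = y0].
Proof.
move=> aA bB fA; pose B' := [seq y <- B | `[<fin_conj (y / b)>]].
have fB y z : y \in B' -> z \in B' -> fin_conj (y / z).
  rewrite !mem_filter => /andP[/asboolP fy _] /andP[/asboolP fz _].
  by rewrite -(mulgKA b^-1); apply: fin_conjF.
pose L := [seq x / y | x <- A, y <- A] ++ [seq x / y | x <- B', y <- B'].
have [|P cP LP] := @exists_cone L.
  move=> c; rewrite mem_cat => /orP[]/allpairsP[[x y] /= [xS yS ->]].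
    by apply: fin_conjF; apply: fA.
  exact: fB.
have tot (S : seq H) : {subset [seq x / y | x <- S, y <- S] <= L} ->
    forall x y, x \in S -> y \in S -> x <> y -> P (x / y) \/ P (y / x).
  move=> SL x y xS yS xy; rewrite -[y / x]invgF; apply: LP => [|/divg1_eq//].
  by apply/SL/allpairsP; exists (x, y).
have [|x0 x0A x0P] := @cone_max P a A cP aA.
  by apply: (tot A) => c cA; rewrite mem_cat cA.
have bB' : b \in B'.
  by rewrite mem_filter bB andbT mulgV; apply/asboolP/fin_conj1.
have [|y0 y0B y0P] := @cone_max P b B' cP bB'.
  by apply: (tot B') => c cB; rewrite mem_cat cB orbT.
move: (y0B); rewrite mem_filter => /andP[/asboolP fy0 y0B_].
exists x0, y0; split=> // x y xA yB xyE.
have yE : y / y0 = x0 / x.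
  have -> : y = x^-1 * (x0 * y0) by rewrite -xyE mulKg.
  rewrite mulgA mulgK; apply: fin_conj_commute; last exact: fA.
  by apply/fin_conjV/fA.
have yB' : y \in B'.
  rewrite mem_filter yB andbT; apply/asboolP; rewrite -(divgKA y0).
  by apply: fin_conjM => //; rewrite yE; apply: fin_conjF; apply: fA.
have [_ P1 _] := cP; have PM := let: And3 PM _ _ := cP in PM.
have [yy0|Py] := y0P y yB'.
  by split=> //; move: yE; rewrite yy0 mulgV => /esym/divg1_eq.
case: P1; have [xx0|Px] := x0P x xA.
  by move: Py; rewrite -invgF yE xx0 mulgV invg1.
by rewrite -(mulVg (y / y0)) invgF; apply: PM => //; rewrite yE.
Qed.

(** * Separating finite sets by conjugation *)

Definition centralizes g l := forall a, a \in l -> commute a g.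

(** Elements of the FC-centre have centralisers of finite index, and finiteness
    of the orbit of [y] under a subgroup of finite index implies finiteness of
    its conjugacy class. The induction drops one element [a] of [l] at a time,
    using for each [f] in the class of [a] a witness [w f] conjugating [a] to
    [f]. *)
Lemma fin_conj_centralizer l F y : (forall a, a \in l -> fin_conj a) ->
  (forall h, centralizes h l -> y ^ h \in F) -> fin_conj y.
Proof.
elim: l F => [|a l IHl] F fl yF; first by exists F => g; apply: yF.
have [r ar] := fl a (mem_head _ _).
have /choice[w wP] f : exists w, (exists2 h, centralizes h l & f = a ^ h) ->
    centralizes w l /\ f = a ^ w.
  have [[h hl fE]|nfE] := pselect (exists2 h, centralizes h l & f = a ^ h).
    by exists h.
  by exists 1 => /nfE.
apply: (IHl [seq u ^ w f | u <- F, f <- r]) => [b bl|h hl].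
  by apply: fl; rewrite inE bl orbT.
have [wl ahw] := wP (a ^ h) (ex_intro2 _ _ h hl erefl).
apply/allpairsP; exists (y ^ (h / w (a ^ h)), a ^ h); split => //=; last first.
  by rewrite -conjgM mulgVK.
apply: yF => b; rewrite inE => /predU1P[->|bl]; last first.
  by apply: commuteM (hl b bl) (commuteV (wl b bl)).
by apply/commgP; rewrite -conjg_fix conjgM {1}ahw conjgK.
Qed.

(** If finitely many points have infinite orbits, the group moves them
    simultaneously out of any finite set. Given [y :: Y], choose for every [f]
    in [F] of the orbit of [y] an element [t f] with [f ^ t f] outside [F]. By
    induction some [x] moves [Y] out of [F] and of all its translates by the
    inverses of the [t f]. If [y ^ x] still lies in [F], then multiplying [x]
    by [t (y ^ x)] moves it out, and leaves [Y] outside [F]. *)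
Lemma separation l Y F : (forall a, a \in l -> fin_conj a) ->
  (forall y, y \in Y -> ~ fin_conj y) ->
  exists2 h, centralizes h l & forall y, y \in Y -> y ^ h \notin F.
Proof.
move=> fl; elim: Y F => [|y Y IHY] F fY.
  by exists 1 => // a _; apply: commute1.
have {fY} [fy fY] : ~ fin_conj y /\ forall y, y \in Y -> ~ fin_conj y.
  by split=> [|z zY]; apply: fY; rewrite inE ?eqxx ?zY ?orbT.
have /choice[t tP] f : exists t, centralizes t l /\
    ((exists2 x, centralizes x l & f = y ^ x) -> f ^ t \notin F).
  have [[x xl ->]|nf] := pselect (exists2 x, centralizes x l & f = y ^ x);
      last first.
    by exists 1; split=> // a _; apply: commute1.
  have /existsNP[h /not_implyP[hl /negP yhF]] :
      ~ forall h, centralizes h l -> y ^ h \in F.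
    by move=> yF; apply: fy; apply: fin_conj_centralizer fl yF.
  exists (x^-1 * h); split=> [a al|_]; last by rewrite -conjgM mulVKg.
  by apply: commuteM (commuteV (xl a al)) (hl a al).
have [x xl xP] := IHY (F ++ [seq u ^ (t f)^-1 | u <- F, f <- F]) fY.
have [yxF|yxF] := boolP (y ^ x \in F); last first.
  exists x => // z /predU1P[->//|/xP]; apply: contra => zxF.
  by rewrite mem_cat zxF.
have [tl /(_ (ex_intro2 _ _ x xl erefl)) yxtF] := tP (y ^ x).
exists (x * t (y ^ x)) => [a al|z]; first exact: commuteM (xl a al) (tl a al).
rewrite inE conjgM => /predU1P[->//|/xP]; apply: contra => zF.
rewrite mem_cat; apply/orP; right; apply/allpairsP.
by exists ((z ^ x) ^ t (y ^ x), y ^ x); split; rewrite /= ?conjgK.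
Qed.

End FiniteConjugacy.

(** * Prime rings in terms of elements *)

Section PrimeRng.
Local Open Scope ring_scope.
Context {S : rngType}.

Lemma ideal_neq0 (I : set S) a : I a -> a <> 0 -> I <> [set 0]%classic.
Proof. by move=> Ia a0 I0; rewrite I0 in Ia. Qed.

Lemma ideal_ex (I : set S) : is_ideal I -> I <> [set 0]%classic ->
  exists2 a, I a & a <> 0.
Proof.
move=> [I0 _ _] In0; apply: contrapT => noa; apply: In0.
rewrite predeqE => a; split=> [Ia|->//].
by apply: contrapT => a0; apply: noa; exists a.
Qed.

Lemma rmulBl (x y z : S) : ((x - y) * z)%g = (x * z)%g - (y * z)%g.
Proof. by apply: (addIr (y * z)%g); rewrite -rmulDl !subrK. Qed.

Lemma rmulBr (x y z : S) : (x * (y - z))%g = (x * y)%g - (x * z)%g.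
Proof. by apply: (addIr (x * z)%g); rewrite -rmulDr !subrK. Qed.

(** If [a] and [b] violate the condition, then the ideal [I] of all [x] such
    that [x b = 0] and [x c b = 0] for every [c], and the right annihilator
    [J] of [I], are nonzero with product zero. Including [x b = 0] in [I]
    compensates for the absence of a unit. *)
Lemma prime_ringP : prime_ring S <->
  forall a b : S, (a * b)%g = 0 -> (forall c, (a * c * b)%g = 0) ->
    a = 0 \/ b = 0.
Proof.
split=> [prS a b ab acb|prS [I [J [idI idJ I0 J0 IJ0]]]]; last first.
  have [[a Ia a0] [b Jb b0]] := (ideal_ex idI I0, ideal_ex idJ J0).
  have IJ x y : I x -> J y -> (x * y)%g = 0.
    move=> Ix Jy; have : ideal_mul I J (x * y)%g.
      by exists [:: (x, y)]; rewrite ?big_seq1 // => p; rewrite inE => /eqP->.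
    by rewrite IJ0.
  have [||//|//] := prS a b; first exact: IJ.
  by move=> c; apply: IJ => //; case: idI => _ _ /(_ c a Ia)[].
apply: contrapT => /not_orP[a0 b0]; apply: prS.
pose I : set S :=
  [set x | (x * b)%g = 0 /\ forall c, (x * c * b)%g = 0]%classic.
pose J : set S := [set y | forall x, I x -> (x * y)%g = 0]%classic.
have idI : is_ideal I.
  split=> [|x y [xb xcb] [yb ycb]|c x [xb xcb]].
  - by split=> [|c]; rewrite !rmul0r.
  - by split=> [|c]; rewrite !rmulBl ?xb ?yb ?xcb ?ycb subrr.
  - split; split=> [|d];
      rewrite -?mulgA ?xb ?[(x * (d * b))%g]mulgA ?xcb ?rmulr0 //.
      by rewrite mulgA xcb.
    by rewrite [(c * _)%g]mulgA mulgA xcb.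
have idJ : is_ideal J.
  split=> [x _|x y Jx Jy z Iz|c y Jy].
  - by rewrite rmulr0.
  - by rewrite rmulBr Jx ?Jy ?subrr.
  - split=> x Ix; last by rewrite mulgA Jy ?rmul0r.
    by rewrite mulgA Jy //; case: idI => _ _ /(_ c x Ix)[].
have Ia : I a by [].
have Jb : J b by move=> x; case.
exists I, J; split=> //; [exact: ideal_neq0 Ia a0|exact: ideal_neq0 Jb b0|].
rewrite predeqE => z; split=> [[s sP ->]|->]; last first.
  by exists [::]; rewrite ?big_nil.
by rewrite big_seq big1 // => p /sP[Ip Jp]; apply: Jp.
Qed.

Lemma prime_s_unital : s_unital S -> prime_ring S ->
  forall x y : S, x != 0 -> y != 0 -> exists r, (x * r * y)%g != 0.
Proof.
move=> uS /prime_ringP prS x y /eqP x0 /eqP y0.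
apply: contrapT => /forallNP xry; have {}xry r : (x * r * y)%g = 0.
  by apply/eqP/negP => /negP; apply: xry.
have [u [_ [uy _]]] := uS y.
by case: (prS x y) => //; rewrite -uy mulgA.
Qed.

End PrimeRng.

(** * Elements of a groupoid ring *)

Section Coefficients.
Local Open Scope ring_scope.
Context {R : rngType} {G : groupoid}.
Implicit Types (a b c : groupoid_ring R G) (g h k : G) (x y z u r : R).

Lemma groupoid_ring_ind (P : groupoid_ring R G -> Prop) :
  P 0 -> (forall x g, P (delta x g)) -> (forall a b, P a -> P b -> P (a + b)) ->
  forall a, P a.
Proof.
move=> P0 Pd PD a; rewrite [a]monalgE.
by apply: big_ind => // g _; apply: Pd.
Qed.

Lemma delta_mulE x g y h : (delta x g * delta y h)%g =
  if gsrc g == grng h then delta (x * y)%g (gcomp g h) else 0.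
Proof. exact: groupoid_ring_mulUU. Qed.

Lemma groupoid_ringE a : a = \sum_(g <- msupp a) delta a@_g g.
Proof. exact: monalgE. Qed.

Lemma mcoeff_groupoid_ring_sum (I : Type) (s : seq I)
    (F : I -> groupoid_ring R G) g :
  (\sum_(i <- s) F i)@_g = \sum_(i <- s) (F i)@_g.
Proof. exact: (raddf_sum (mcoeff g)). Qed.

Lemma groupoid_ring_suml (I : Type) (s : seq I) (F : I -> groupoid_ring R G) a :
  ((\sum_(i <- s) F i) * a)%g = \sum_(i <- s) (F i * a)%g.
Proof. exact: groupoid_ring_mul_suml. Qed.

Lemma groupoid_ring_sumr (I : Type) (s : seq I) (F : I -> groupoid_ring R G) a :
  (a * \sum_(i <- s) F i)%g = \sum_(i <- s) (a * F i)%g.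
Proof. exact: groupoid_ring_mul_sumr. Qed.

Lemma msupp_neq0 a : a <> 0 -> exists g, g \in msupp a.
Proof.
move=> a0; apply: contrapT => /forallNP na; apply: a0; apply/malgP => g.
by rewrite mcoeff0 mcoeff_outdom //; apply/negP.
Qed.

Lemma mcoeff_delta x g h : (delta x g)@_h = x *+ (g == h).
Proof. exact: mcoeffU. Qed.

Lemma delta0 g : delta 0 g = 0 :> groupoid_ring R G.
Proof. exact: monalgU0. Qed.

Lemma mcoeffM_delta_l x g a h : gsrc g = grng h ->
  (delta x g * a)%g@_(gcomp g h) = (x * a@_h)%g.
Proof.
move=> gh; elim/groupoid_ring_ind: a => [|y k|a b IHa IHb].
- by rewrite !mcoeff0 rmulr0 rmulr0 mcoeff0.
- rewrite delta_mulE mcoeff_delta; have [gk|gk] := eqVneq (gsrc g) (grng k).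
    rewrite mcoeff_delta; have [->|kh] := eqVneq k h; first by rewrite eqxx.
    suff /negPf-> : gcomp g k != gcomp g h by rewrite mulr0n rmulr0.
    apply: contra kh => /eqP gkh; rewrite -[k]gcomp_idl -[h]gcomp_idl -gk -gh.
    by rewrite -gcomp_invl -!gcompA ?gsrc_inv // gkh.
  rewrite mcoeff0; have [kh|_] := eqVneq k h; first by rewrite kh gh eqxx in gk.
  by rewrite mulr0n rmulr0.
- by rewrite rmulDr !mcoeffD IHa IHb rmulDr.
Qed.

Lemma mcoeffM_delta_r a x g h : gsrc h = grng g ->
  (a * delta x g)%g@_(gcomp h g) = (a@_h * x)%g.
Proof.
move=> hg; elim/groupoid_ring_ind: a => [|y k|a b IHa IHb].
- by rewrite !mcoeff0 rmul0r rmul0r mcoeff0.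
- rewrite delta_mulE mcoeff_delta; have [kg|kg] := eqVneq (gsrc k) (grng g).
    rewrite mcoeff_delta; have [->|kh] := eqVneq k h; first by rewrite eqxx.
    suff /negPf-> : gcomp k g != gcomp h g by rewrite mulr0n rmul0r.
    apply: contra kh => /eqP gkh; rewrite -[k]gcomp_idr -[h]gcomp_idr kg hg.
    by rewrite -gcomp_invr !gcompA ?grng_inv // gkh.
  rewrite mcoeff0; have [kh|_] := eqVneq k h; first by rewrite kh hg eqxx in kg.
  by rewrite mulr0n rmul0r.
- by rewrite rmulDl !mcoeffD IHa IHb rmulDl.
Qed.

Lemma mul_delta_eq0 a b : (forall x g, (a * delta x g * b)%g = 0) ->
  forall c, (a * c * b)%g = 0.
Proof.
move=> ab; elim/groupoid_ring_ind => [|//|c d IHc IHd].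
  by rewrite rmulr0 rmul0r.
by rewrite rmulDr rmulDl IHc IHd addr0.
Qed.

Lemma prime_coefficients (e : obj G) :
  prime_ring (groupoid_ring R G) -> prime_ring R.
Proof.
move=> /prime_ringP prG; apply/prime_ringP => x y xy xry.
have [|||] := prG (delta x (gid e)) (delta y (gid e)).
- by rewrite delta_mulE xy delta0 if_same.
- apply: mul_delta_eq0 => r g; rewrite delta_mulE.
  case: ifP => _; last by rewrite rmul0r.
  by rewrite delta_mulE xry delta0 if_same.
- by move/eqP; rewrite monalgU_eq0 => /eqP; left.
- by move/eqP; rewrite monalgU_eq0 => /eqP; right.
Qed.

(** If no arrow goes from [e] to [f], then the elements [delta x (gid f)] and
    [delta x (gid e)] annihilate each other across the whole ring. *)
Lemma prime_connected : (exists x : R, x != 0) ->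
  prime_ring (groupoid_ring R G) -> groupoid_connected G.
Proof.
move=> [x /eqP x0] /prime_ringP prG e f; apply: contrapT => noef.
have nog g : gsrc g = e -> grng g <> f by move=> ge gf; apply: noef; exists g.
have dx h : delta x h <> 0 :> groupoid_ring R G.
  by move/eqP; rewrite monalgU_eq0 => /eqP.
have [||/dx|/dx] := prG (delta x (gid f)) (delta x (gid e)) => //.
  rewrite delta_mulE gsrc_id grng_id; case: eqP => // fe.
  by case: (nog (gid e)); rewrite ?gsrc_id ?grng_id.
apply: mul_delta_eq0 => r g; rewrite delta_mulE gsrc_id.
case: eqP => [fg|_]; last by rewrite rmul0r.
rewrite delta_mulE gsrc_comp ?gsrc_id // grng_id; case: eqP => // ge.
by case: (nog g ge).
Qed.

Lemma ring_dense_all (X : set (obj G)) : (exists x : R, x != 0) ->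
  ring_dense R X -> forall e, X e.
Proof.
move=> [x x0] Xd e; have [|g] := Xd (delta x (gid e)).
  by rewrite monalgU_eq0.
by rewrite msuppU (negPf x0) inE => /eqP->; rewrite gsrc_id.
Qed.

Lemma ring_dense_orbit_connected (e : obj G) : (exists x : R, x != 0) ->
  ring_dense R (groupoid_orbit e) -> groupoid_connected G.
Proof.
move=> R0 /(ring_dense_all R0) orb f f'.
have [[g ge gf] [g' g'e g'f']] := (orb f, orb f').
exists (gcomp g' (ginv g));
  rewrite ?gsrc_comp ?grng_comp ?gsrc_inv ?grng_inv //;
  by rewrite ge g'e.
Qed.

Lemma connected_ring_dense_orbit (e : obj G) :
  groupoid_connected G -> ring_dense R (groupoid_orbit e).
Proof.
move=> cG a a0; have [g ga] := msupp_neq0 (elimN eqP a0).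
by exists g => //; apply: cG.
Qed.

End Coefficients.

Arguments groupoid_ring_ind : clear implicits.

(** * The isotropy group ring as a corner *)

Section IsotropyEmbedding.
Local Open Scope ring_scope.
Context {R : rngType} {G : groupoid} {e : obj G}.
Implicit Types (a b c : groupoid_ring R G) (g : G) (x y : R).
Implicit Types al be : group_ring R (isotropy e).

Definition isotropy_extend al : groupoid_ring R G :=
  \sum_(x <- msupp al) delta al@_x (isotropy_mor x).

Lemma isotropy_extendw (d : {fset isotropy e}) al : (msupp al `<=` d)%fset ->
  isotropy_extend al = \sum_(x <- d) delta al@_x (isotropy_mor x).
Proof.
move=> le_d; apply: big_fset_incl => // x _ /mcoeff_outdom ->.
exact: delta0.
Qed.

Lemma isotropy_extendD al be :
  isotropy_extend (al + be) = isotropy_extend al + isotropy_extend be.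
Proof.
pose d := (msupp al `|` msupp be)%fset.
rewrite (@isotropy_extendw d) ?msuppD_le //.
rewrite (@isotropy_extendw d al) ?fsubsetUl //.
rewrite (@isotropy_extendw d be) ?fsubsetUr //.
by rewrite -big_split; apply: eq_bigr => x _; rewrite mcoeffD /delta monalgUD.
Qed.

Lemma isotropy_extend0 : isotropy_extend 0 = 0.
Proof. by rewrite /isotropy_extend msupp0 big_seq_fset0. Qed.

Lemma isotropy_extend_delta (x : R) (g : group_groupoid (isotropy e)) :
  isotropy_extend (delta x g) = delta x (isotropy_mor g).
Proof.
by rewrite (isotropy_extendw msuppU_le) big_seq_fset1 mcoeffUU.
Qed.

Lemma isotropy_extendM al be :
  isotropy_extend (al * be)%g = (isotropy_extend al * isotropy_extend be)%g.
Proof.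
elim/groupoid_ring_ind: al => [|x g|al al' IH IH'].
- by rewrite rmul0r isotropy_extend0 rmul0r.
- elim/groupoid_ring_ind: be => [|y h|be be' IH IH'].
  + by rewrite rmulr0 isotropy_extend0 rmulr0.
  + rewrite delta_mulE eqxx !isotropy_extend_delta delta_mulE.
    by rewrite isotropy_src isotropy_rng eqxx.
  + by rewrite rmulDr !isotropy_extendD IH IH' rmulDr.
- by rewrite rmulDl !isotropy_extendD IH IH' rmulDl.
Qed.

Lemma mcoeff_isotropy_extend al (x : group_groupoid (isotropy e)) :
  (isotropy_extend al)@_(isotropy_mor x) = al@_x.
Proof.
elim/groupoid_ring_ind: al => [|y g|al al' IH IH'].
- by rewrite isotropy_extend0 !mcoeff0.
- by rewrite isotropy_extend_delta !mcoeff_delta (inj_eq val_inj).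
- by rewrite isotropy_extendD !mcoeffD IH IH'.
Qed.

Lemma isotropy_extend_inj al : isotropy_extend al = 0 -> al = 0.
Proof.
by move=> al0; apply/malgP => x; rewrite -mcoeff_isotropy_extend al0 !mcoeff0.
Qed.

Lemma isotropy_extend_mul_delta al x g : grng g <> e ->
  (isotropy_extend al * delta x g)%g = 0.
Proof.
move=> ge; elim/groupoid_ring_ind: al => [|y h|al al' IH IH'].
- by rewrite isotropy_extend0 rmul0r.
- rewrite isotropy_extend_delta delta_mulE isotropy_src.
  by case: eqP => // eg; case: ge.
- by rewrite isotropy_extendD rmulDl IH IH' addr0.
Qed.

Lemma delta_mul_isotropy_extend al x g : gsrc g <> e ->
  (delta x g * isotropy_extend al)%g = 0.
Proof.
move=> ge; elim/groupoid_ring_ind: al => [|y h|al al' IH IH'].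
- by rewrite isotropy_extend0 rmulr0.
- by rewrite isotropy_extend_delta delta_mulE isotropy_rng; case: eqP.
- by rewrite isotropy_extendD rmulDr IH IH' addr0.
Qed.

(** Between two elements supported on the isotropy group at [e], only the part
    of the middle factor supported on that group contributes. *)
Lemma prime_isotropy :
  prime_ring (groupoid_ring R G) -> prime_ring (group_ring R (isotropy e)).
Proof.
move=> /prime_ringP prG; apply/prime_ringP => al be ab acb.
have [|||] := prG (isotropy_extend al) (isotropy_extend be).
- by rewrite -isotropy_extendM ab isotropy_extend0.
- apply: mul_delta_eq0 => x g; have [ge|ge] := eqVneq (grng g) e; last first.
    by rewrite isotropy_extend_mul_delta ?rmul0r //; apply/eqP.
  have [sg|sg] := eqVneq (gsrc g) e; last first.
    by rewrite -mulgA delta_mul_isotropy_extend ?rmulr0 //; apply/eqP.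
  have gP : (gsrc g == e) && (grng g == e) by rewrite sg ge eqxx.
  rewrite -[g]/(isotropy_mor (Isotropy gP)) -isotropy_extend_delta.
  by rewrite -!isotropy_extendM acb isotropy_extend0.
- by move/isotropy_extend_inj; left.
- by move/isotropy_extend_inj; right.
Qed.

Lemma isotropy_corner a x y q p : grng q = e -> gsrc p = e ->
  exists al, isotropy_extend al = (delta x q * a * delta y p)%g.
Proof.
move=> qe pe; elim/groupoid_ring_ind: a => [|z g|a b [al IH] [be IH']].
- by exists 0; rewrite isotropy_extend0 rmulr0 rmul0r.
- rewrite delta_mulE; case: eqP => [qg|_]; last first.
    by exists 0; rewrite rmul0r isotropy_extend0.
  rewrite delta_mulE gsrc_comp //; case: eqP => [gp|_]; last first.
    by exists 0; rewrite isotropy_extend0.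
  have kP : (gsrc (gcomp (gcomp q g) p) == e) &&
            (grng (gcomp (gcomp q g) p) == e).
    by rewrite gsrc_comp ?grng_comp ?gsrc_comp // pe qe eqxx.
  exists (delta (x * z * y)%g (Isotropy kP : group_groupoid _)).
  by rewrite isotropy_extend_delta.
- by exists (al + be); rewrite isotropy_extendD IH IH' rmulDr rmulDl.
Qed.

(** Take [g] in the support of [a], and arrows [q] from its range to [e] and
    [p] from [e] to its source. Multiplying by [delta x q] and [delta y p],
    where [x] and [y] are local units of the coefficient of [a] at [g], moves
    this coefficient unchanged to the isotropy group. *)
Lemma isotropy_corner_neq0 a : s_unital R -> groupoid_connected G -> a <> 0 ->
  exists b c al, al <> 0 /\ isotropy_extend al = (b * a * c)%g.
Proof.
move=> uR cG /msupp_neq0[g ga].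
have [q qg qe] := cG (grng g) e; have [p pe pg] := cG e (gsrc g).
have [x [y [xa ay]]] := uR a@_g.
have [al alE] := isotropy_corner a x y qe pe.
exists (delta x q), (delta y p), al; split=> // al0.
move: ga; rewrite -mcoeff_neq0 => /eqP; apply.
rewrite ay -[X in (X * _)%g]xa -(@mcoeffM_delta_l _ _ x q) //.
rewrite -(@mcoeffM_delta_r _ _ _ y p) ?gsrc_comp //.
by rewrite -alE al0 isotropy_extend0 mcoeff0.
Qed.

Lemma connected_prime : s_unital R -> groupoid_connected G ->
  prime_ring (group_ring R (isotropy e)) -> prime_ring (groupoid_ring R G).
Proof.
move=> uR cG /prime_ringP prH; apply/prime_ringP => a b ab acb.
apply: contrapT => /not_orP[a0 b0].
have [l [r [al [al0 alE]]]] := isotropy_corner_neq0 uR cG a0.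
have [l' [r' [be [be0 beE]]]] := isotropy_corner_neq0 uR cG b0.
have ab0 c : (isotropy_extend al * c * isotropy_extend be)%g = 0.
  rewrite alE beE; have -> : (l * a * r * c * (l' * b * r') =
    l * (a * (r * c * l') * b) * r')%g by rewrite !mulgA.
  by rewrite acb rmulr0 rmul0r.
case: (prH al be) => // [|ga]; apply: isotropy_extend_inj;
  rewrite !isotropy_extendM //.
rewrite alE beE; have -> : (l * a * r * (l' * b * r') =
    l * (a * (r * l') * b) * r')%g by rewrite !mulgA.
by rewrite acb rmulr0 rmul0r.
Qed.

End IsotropyEmbedding.

(** * Prime group rings *)

Section GroupRing.
Local Open Scope group_scope.
Local Open Scope ring_scope.
Context {R : rngType} {H : groupType}.
Local Notation RH := (group_ring R H).
Implicit Types (a b c : RH) (g h k : H) (x y z r : R).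

Lemma group_delta_mulE x g y h :
  (delta x (g : group_groupoid H) * delta y (h : group_groupoid H))%g =
  delta (x * y)%g ((g * h)%g : group_groupoid H) :> RH.
Proof. exact: delta_mulE. Qed.

(** The index type is [H] itself here, as simplification unfolds
    [mor (group_groupoid H)] to it. *)
Lemma group_mcoeff_delta x g h :
  @mcoeff H R h (delta x (g : group_groupoid H)) = x *+ (g == h).
Proof. exact: (@mcoeff_delta R (group_groupoid H)). Qed.

Lemma mcoeff_mul_delta_mul a r k b (w : group_groupoid H) :
  (a * delta r (k : group_groupoid H) * b)%g@_w =
  \sum_(g <- msupp a) \sum_(h <- msupp b)
     (a@_g * r * b@_h)%g *+ ((g : H) * k * (h : H) == w)%g.
Proof.
have -> : (a * delta r (k : group_groupoid H))%g = \sum_(g <- msupp a)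
    delta (a@_g * r)%g (((g : H) * k)%g : group_groupoid H).
  rewrite [a in LHS]groupoid_ringE groupoid_ring_suml.
  by apply: eq_bigr => g _; apply: group_delta_mulE.
rewrite groupoid_ring_suml mcoeff_groupoid_ring_sum; apply: eq_bigr => g _.
rewrite [b in LHS]groupoid_ringE groupoid_ring_sumr mcoeff_groupoid_ring_sum.
by apply: eq_bigr => h _; rewrite group_delta_mulE mcoeff_delta.
Qed.

(** For [n] in a finite normal subgroup [N], the sum of [N] commutes with [H]
    and absorbs [n], so it annihilates [1 - n] across the whole ring. In the
    absence of a unit, both elements carry a nonzero coefficient [x]. *)
Lemma prime_no_finite_normal : (exists x : R, x != 0) ->
  prime_ring RH -> no_nontrivial_finite_normal_subgroup H.
Proof.
move=> [x x0] /prime_ringP prRH N [N1 ND] Nn.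
have NM : mulg_closed [in N] by apply: group_closedM.
apply/eqP; rewrite eqEfsubset; apply/andP; split; last first.
  by apply/fsubsetP => g; rewrite inE => /eqP->.
apply/fsubsetP => n nN; rewrite inE; apply: contrapT => /negP n1.
pose S y g : RH := \sum_(m <- N) delta y ((m * g)%g : group_groupoid H).
have SM y g z h :
    (S y g * delta z (h : group_groupoid H))%g = S (y * z)%g (g * h)%g.
  rewrite /S groupoid_ring_suml; apply: eq_bigr => m _.
  by rewrite [LHS]group_delta_mulE mulgA.
(* [N g n = N (n ^ g^-1) g], and normality puts [n ^ g^-1] in [N]. *)
have SN y g : S y (g * n)%g = S y g.
  have nN' : (n ^ g^-1)%g \in N by apply: Nn.
  rewrite /S [RHS](perm_big [seq (m * n ^ g^-1)%g | m <- N]) /=.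
    rewrite big_map; apply: eq_bigr => m _; congr delta.
    by rewrite -mulgA -conjgCV.
  apply: uniq_perm => [||m]; rewrite ?(map_inj_uniq (mulIg _)) ?fset_uniq //.
  apply/idP/mapP => [mN|[m' m'N ->]]; last exact: NM.
  by exists (m / n ^ g^-1)%g; [apply: ND|rewrite mulgVK].
pose d : RH :=
  delta x (1%g : group_groupoid H) - delta x (n : group_groupoid H).
have Sd y g : (S y g * d)%g = 0.
  by rewrite rmulBr !SM SN mulg1 subrr.
have [|||] := prRH (S x 1%g) d; first exact: Sd.
- by apply: mul_delta_eq0 => r g; rewrite SM Sd.
- move=> /(congr1 (@mcoeff (group_groupoid H) _ 1%g)).
  rewrite mcoeff0 mcoeff_groupoid_ring_sum (bigD1_seq 1%g) ?fset_uniq //= big1.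
    by rewrite group_mcoeff_delta mulg1 eqxx addr0 => /eqP; rewrite (negPf x0).
  by move=> m m1; rewrite group_mcoeff_delta mulg1 (negPf m1).
- move=> /(congr1 (@mcoeff (group_groupoid H) _ 1%g)).
  rewrite mcoeff0 mcoeffB !mcoeff_delta eqxx (negPf n1) subr0.
  by move=> /eqP; rewrite (negPf x0).
Qed.

(** Let [A] be the part of [supp a * g0^-1] in the FC-centre, and [Y] the rest.
    Choose a unique product [g1 * h1] of [A] and [supp b], an element [k] that
    commutes with [A] and conjugates [Y] away from the finite set of all
    [g1 * h1 / h], and [r] with [a_(g1 g0) r b_h1] nonzero. In
    [a * delta r (g0^-1 * k) * b], the coefficient at [k * (g1 * h1)] is then
    exactly [a_(g1 g0) r b_h1]: a factor [g] of [a] contributes through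
    [(g / g0) ^ k * h = g1 * h1], which is impossible for [g / g0] in [Y] by
    the choice of [k], and for [g / g0] in [A] it reads
    [(g / g0) * h = g1 * h1]. *)
Lemma no_finite_normal_prime : s_unital R -> prime_ring R ->
  no_nontrivial_finite_normal_subgroup H -> prime_ring RH.
Proof.
move=> uR prR Hfin; apply/prime_ringP => a b _ acb.
apply: contrapT => /not_orP[/msupp_neq0[g0 g0a] /msupp_neq0[h0 h0b]].
pose A0 : seq H := [seq ((g : H) / g0)%g | g <- msupp a].
pose A := [seq g <- A0 | `[< fin_conj g >]].
pose Y := [seq g <- A0 | ~~ `[< fin_conj g >]].
have A1 : 1%g \in A.
  rewrite mem_filter; apply/andP; split; first by apply/asboolP/fin_conj1.
  by apply/mapP; exists g0; rewrite // mulgV.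
have fA g : g \in A -> fin_conj g by rewrite mem_filter => /andP[/asboolP].
have fY g : g \in Y -> ~ fin_conj g by rewrite mem_filter => /andP[/asboolPn].
have [g1 [h1 [g1A h1b uniq1]]] := unique_product Hfin A1 h0b fA.
have [k kA kY] := separation [seq (g1 * h1 / (h : H))%g | h <- msupp b] fA fY.
have g1a : (g1 * g0)%g \in msupp a.
  by move: g1A; rewrite mem_filter => /andP[_ /mapP[g ga ->]]; rewrite mulgVK.
have [r /eqP] : exists r, (a@_(g1 * g0)%g * r * b@_h1)%g != 0.
  by apply: prime_s_unital => //; rewrite mcoeff_neq0.
apply.
have := acb (delta r ((g0^-1 * k)%g : group_groupoid H)).
move=> /(congr1 (@mcoeff (group_groupoid H) _ (k * (g1 * h1))%g)).
rewrite mcoeff0 mcoeff_mul_delta_mul.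
have key g h : g \in msupp a -> h \in msupp b ->
    (g * (g0^-1 * k) * h == k * (g1 * h1))%g = (g == g1 * g0)%g && (h == h1).
  move=> ga hb; apply/eqP/andP => [E|[/eqP-> /eqP->]]; last first.
    rewrite !mulgA mulgK -[(k * g1)%g](kA g1) //.
  have gE : ((g / g0) ^ k = g1 * h1 / h)%g.
    apply: (mulIg h); rewrite mulgVK conjgE -mulgA; apply: (mulgI k).
    by rewrite mulVKg -E !mulgA.
  have gA0 : (g / g0)%g \in A0 by apply: map_f.
  have [fg|nfg] := pselect (fin_conj (g / g0)%g); last first.
    have : (g / g0)%g \in Y by rewrite mem_filter gA0 andbT; apply/asboolPn.
    by move/kY; case/negP; rewrite gE; apply/mapP; exists h.
  have gA : (g / g0)%g \in A by rewrite mem_filter gA0 andbT; apply/asboolP.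
  have [|gg1 ->] := uniq1 _ h gA hb.
    have <- : ((g / g0) ^ k = g / g0)%g by apply/conjg_fixP/commgP/kA.
    by rewrite gE mulgVK.
  by rewrite -gg1 mulgVK !eqxx.
rewrite (bigD1_seq (g1 * g0)%g) ?fset_uniq //=.
rewrite (bigD1_seq h1) ?fset_uniq //= key // !eqxx mulr1n.
rewrite [X in _ + X + _]big_seq_cond [X in _ + X + _]big1; last first.
  by move=> h /andP[hb hh]; rewrite key // (negPf hh) andbF.
rewrite [X in _ + X]big_seq_cond [X in _ + X]big1; last first.
  move=> g /andP[ga gg]; rewrite big_seq big1 // => h hb.
  by rewrite key // (negPf gg).
by rewrite !addr0.
Qed.

End GroupRing.

Local Open Scope ring_scope.

Theorem theorem4p28 (G : groupoid) (R : rngType) (G_nonempty : inhabited G)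
    (R_nonzero : exists x : R, x != 0) (R_s_unital : s_unital R) :
  [<->
    (* i *) prime_ring (groupoid_ring R G);
    (* ii *) groupoid_connected G /\
      exists e : obj G, prime_ring (group_ring R (isotropy e));
    (* iii *) groupoid_connected G /\
      forall e : obj G, prime_ring (group_ring R (isotropy e));
    (* iv *) exists e : obj G,
      ring_dense R (groupoid_orbit e) /\ prime_ring (group_ring R (isotropy e));
    (* v *) forall e : obj G,
      ring_dense R (groupoid_orbit e) /\ prime_ring (group_ring R (isotropy e));
    (* vi *) [/\ groupoid_connected G, prime_ring R &
      exists e : obj G, no_nontrivial_finite_normal_subgroup (isotropy e)];
    (* vii *) [/\ groupoid_connected G, prime_ring R &
      forall e : obj G, no_nontrivial_finite_normal_subgroup (isotropy e)];
    (* viii *) prime_ring R /\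
      exists e : obj G, ring_dense R (groupoid_orbit e) /\
        no_nontrivial_finite_normal_subgroup (isotropy e);
    (* ix *) prime_ring R /\
      forall e : obj G, ring_dense R (groupoid_orbit e) /\
        no_nontrivial_finite_normal_subgroup (isotropy e)
  ].
Proof.
have [g0] := G_nonempty; pose e0 := gsrc g0.
have dense (e : obj G) :
    groupoid_connected G -> ring_dense R (groupoid_orbit e).
  exact: connected_ring_dense_orbit.
have conn (e : obj G) : ring_dense R (groupoid_orbit e) -> groupoid_connected G.
  exact: ring_dense_orbit_connected.
have up (e : obj G) : groupoid_connected G ->
    prime_ring (group_ring R (isotropy e)) ->
    prime_ring (groupoid_ring R G) by exact: connected_prime.
have connell (e : obj G) : prime_ring (group_ring R (isotropy e)) <->
    prime_ring R /\ no_nontrivial_finite_normal_subgroup (isotropy e).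
  split=> [prH|[]]; last exact: no_finite_normal_prime.
  by split; [exact: prime_coefficients prH | exact: prime_no_finite_normal prH].
(* Passing from one object to all others goes through the primeness of the
   whole groupoid ring. *)
tfae.
- move=> prG; split; first exact: prime_connected R_nonzero prG.
  by exists e0; exact: prime_isotropy.
- by move=> [cG [e /(up e cG) prG]]; split=> // f; exact: prime_isotropy.
- by move=> [cG prH]; exists e0; split; [exact: dense|].
- move=> [e [/conn cG /(up e cG) prG]] f.
  by split; [exact: dense|exact: prime_isotropy].
- move=> prH; have [/conn cG /connell[prR nof]] := prH e0.
  by split=> //; exists e0.
- move=> [cG prR [e nof]]; split=> // f.
  have /(up e cG) prG : prime_ring (group_ring R (isotropy e)) by apply/connell.
  by have /connell[] := @prime_isotropy _ _ f prG.
- by move=> [cG prR nof]; split=> //; exists e0; split; [exact: dense|].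
- move=> [prR [e [/conn cG nof]]]; split=> // f; split; first exact: dense.
  have /(up e cG) prG : prime_ring (group_ring R (isotropy e)) by apply/connell.
  by have /connell[] := @prime_isotropy _ _ f prG.
- move=> [prR /(_ e0)[/conn cG nof]]; apply: (up e0 cG).
  by apply/connell.
Qed.
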